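(* Let $P$ be a finite poset with minimum $\hat 0$ and let $\phi:\phi(0)=\hat 0<\phi(1)<\dots<\phi(n-1)$ be a chain in $P$. Then the lattice $\mathrm{Tam}(P,\phi)$ is join-congruence uniform.
   Context: For $x\in P$, $I_P(x)=\{y\in P\mid y\le x\}$. For $0\le k<n$ let $\mathcal C_k:=I_P(\phi(k))\times\{k\}$, and let $\mathcal C_P^\phi:=\bigsqcup_{k<n}\mathcal C_k$ be the disjoint union of posets, i.e. $(x,i)\le(y,j)$ iff $i=j$ and $x\le y$ in $P$. An order filter of $\mathcal C_P^\phi$ is an up-closed subset for this order. An order filter $F$ of $\mathcal C_P^\phi$ is torclosed if for all $i<j<n$: $(x,i)\in F$ and $(\phi(i+1),j)\in F$ imply $(x,j)\in F$. $\mathrm{Tam}(P,\phi)$ is the set of torclosed subsets of $\mathcal C_P^\phi$ ordered by inclusion; it is a finite lattice whose meet is intersection. For a convex subset $C$ of a finite lattice $L$, let $I_L(C)=\{y\in L\mid\exists x\in C,\ y\le x\}$; the doubling $L[C]$ is the lattice obtained as the subposet of $L\times\{0<1\}$ on $\big(I_L(C)\times\{0\}\big)\sqcup\big[\big((L\setminus I_L(C))\cup C\big)\times\{1\}\big]$. A lower pseudo-interval of $L$ is a union of intervals sharing the same minimum element, and it is doubled only when convex. A lattice is join-congruence uniform (also called lower bounded) if it is, up to isomorphism, obtained from the one-element lattice by successive doublings of lower pseudo-intervals. *)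

(* Defs.v *)
From HB Require Import structures.
From mathcomp Require Import all_boot all_order.

Set Implicit Arguments.
Unset Strict Implicit.
Unset Printing Implicit Defensive.

Import Order.TTheory.
Local Open Scope order_scope.

Definition principal_ideal d (P : finPOrderType d) (x : P) : {set P} :=
  [set y | y <= x].

Section Tamari.
Context {d : Order.disp_t} {P : finPOrderType d} {n : nat}.
Implicit Type (phi : 'I_n -> P).

(* [C_P phi] is the carrier of the disjoint union of posets, a pair (x, i)
   being the element x of the i-th component; [C_le] is its order. *)
Definition C_comp phi (k : 'I_n) : {set P * 'I_n} :=
  setX (principal_ideal (phi k)) [set k].

Definition C_P phi : {set P * 'I_n} := \bigcup_(k < n) C_comp phi k.

Definition C_le (u v : P * 'I_n) : bool := (u.2 == v.2) && (u.1 <= v.1).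

Definition order_filter phi (F : {set P * 'I_n}) : bool :=
  (F \subset C_P phi) &&
  [forall u in F, [forall v in C_P phi, C_le u v ==> (v \in F)]].

(* The index i' stands for i + 1, which is < n because i < j < n. *)
Definition torclosed phi (F : {set P * 'I_n}) : bool :=
  order_filter phi F &&
  [forall i : 'I_n, forall i' : 'I_n, forall j : 'I_n, forall x : P,
     [&& i' == i.+1 :> nat, (i < j)%N, (x, i) \in F & (phi i', j) \in F]
       ==> ((x, j) \in F)].

Definition is_chain phi := forall i j : 'I_n, (i < j)%N -> phi i < phi j.

Record Tam phi (phi_lt : is_chain phi) := MkTam {
  Tam_set : {set P * 'I_n};
  _ : torclosed phi Tam_set
}.

Lemma in_C_P phi x i : ((x, i) \in C_P phi) = (x <= phi i).
Proof.
apply/bigcupP/idP => [[k _]|le_x].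
  by rewrite !inE /= => /andP[le_x /eqP->].
by exists i => //; rewrite !inE /= le_x eqxx.
Qed.

Lemma order_filterP phi (F : {set P * 'I_n}) :
  reflect ((forall x i, (x, i) \in F -> x <= phi i) /\
           (forall x y i, (x, i) \in F -> x <= y -> y <= phi i -> (y, i) \in F))
          (order_filter phi F).
Proof.
apply: (iffP andP) => -[].
  move=> /subsetP sF /forall_inP upF; split=> [x i /sF|x y i Fx le_xy le_y].
    by rewrite in_C_P.
  have /forall_inP/(_ (y, i)) := upF _ Fx.
  by rewrite in_C_P le_y /C_le /= eqxx le_xy; apply.
move=> sF upF; split; first by apply/subsetP => -[x i] /sF; rewrite in_C_P.
apply/forall_inP => -[x i] Fx; apply/forall_inP => -[y j]; rewrite in_C_P => le_y.
by apply/implyP => /andP[/= /eqP eq_ij le_xy]; subst j; apply: upF Fx _ _.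
Qed.

Lemma torclosedP phi (F : {set P * 'I_n}) :
  reflect (order_filter phi F /\
           forall (i i' j : 'I_n) x, i' = i.+1 :> nat -> (i < j)%N ->
             (x, i) \in F -> (phi i', j) \in F -> (x, j) \in F)
          (torclosed phi F).
Proof.
apply: (iffP andP) => -[filF clF]; split=> //.
  move=> i i' j x /eqP i'E ltij Fx Fj.
  have /forallP/(_ i')/forallP/(_ j)/forallP/(_ x) := forallP clF i.
  by rewrite i'E ltij Fx Fj.
apply/forallP=> i; apply/forallP=> i'; apply/forallP=> j; apply/forallP=> x.
by apply/implyP => /and4P[/eqP]; apply: clF.
Qed.

Lemma torclosedI phi (F G : {set P * 'I_n}) :
  torclosed phi F -> torclosed phi G -> torclosed phi (F :&: G).
Proof.
move=> /torclosedP[/order_filterP[sF upF] clF].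
move=> /torclosedP[/order_filterP[sG upG] clG].
apply/torclosedP; split; first apply/order_filterP; first split.
- by move=> x i /setIP[/sF].
- move=> x y i /setIP[Fx Gx] le_xy le_y.
  by rewrite inE (upF x) //= (upG x).
- move=> i i' j x i'E ltij /setIP[Fx Gx] /setIP[Fj Gj].
  by rewrite inE (clF i i') //= (clG i i').
Qed.

Lemma torclosed_C_P phi : is_chain phi -> torclosed phi (C_P phi).
Proof.
move=> phi_lt; apply/torclosedP; split.
  by apply/order_filterP; split=> [x i|x y i _ _]; rewrite in_C_P.
move=> i i' j x _ /phi_lt/ltW le_ij; rewrite !in_C_P => le_x _.
exact: le_trans le_ij.
Qed.

End Tamari.

Section TamLattice.
Context {d : Order.disp_t} {P : finPOrderType d} {n : nat} {phi : 'I_n -> P}.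
Variable phi_lt : is_chain phi.
Local Notation T := (Tam phi_lt).
Implicit Types F G H : T.

HB.instance Definition _ := [isSub for @Tam_set _ _ _ _ phi_lt].
HB.instance Definition _ := [Finite of T by <:].
Definition Tam_le : rel T := fun F G => Tam_set F \subset Tam_set G.

Lemma Tam_le_refl : reflexive Tam_le.
Proof. by move=> F; apply: subxx. Qed.

Lemma Tam_le_anti : antisymmetric Tam_le.
Proof. by move=> F G FG; apply/val_inj/eqP; rewrite eqEsubset. Qed.

Lemma Tam_le_trans : transitive Tam_le.
Proof. by move=> G F H; apply: subset_trans. Qed.

HB.instance Definition _ := Order.Le_isPOrder.Build
  Order.SetSubsetOrder.subset_display T Tam_le_refl Tam_le_anti Tam_le_trans.

Lemma Tam_leE F G : (F <= G) = (val F \subset val G).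
Proof. by []. Qed.

Definition Tam_meet F G : T := Sub _ (torclosedI (valP F) (valP G)).

Definition Tam_top : T := Sub _ (torclosed_C_P phi_lt).

Definition Tam_join F G : T :=
  \big[Tam_meet/Tam_top]_(H : T | (F <= H) && (G <= H)) H.

Lemma Tam_meetP H F G : (H <= Tam_meet F G) = (H <= F) && (H <= G).
Proof. by rewrite !Tam_leE /= subsetI. Qed.

Lemma Tam_lex1 F : F <= Tam_top.
Proof. by rewrite Tam_leE /=; case/torclosedP: (valP F) => /andP[]. Qed.

Lemma Tam_joinP F G H : (Tam_join F G <= H) = (F <= H) && (G <= H).
Proof.
have upper K : (forall H', (F <= H') && (G <= H') -> K <= H') ->
    K <= Tam_join F G.
  move=> le_K; rewrite /Tam_join.
  elim/big_rec: _ => [|H' M leH' le_M]; first exact: Tam_lex1.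
  by rewrite Tam_meetP le_K.
apply/idP/idP => [le_H|FGH].
  by rewrite !(le_trans _ le_H) // upper // => K /andP[].
rewrite /Tam_join.
have : H \in index_enum T by rewrite mem_index_enum.
elim: (index_enum T) => //= K s IHs; rewrite inE big_cons => /predU1P[<-|/IHs le_s].
  rewrite FGH; set M := \big[_/_]_(_ <- _ | _) _.
  by have := lexx (Tam_meet H M); rewrite Tam_meetP => /andP[].
case: ifP => // _; apply: le_trans le_s; set M := \big[_/_]_(_ <- _ | _) _.
by have := lexx (Tam_meet K M); rewrite Tam_meetP => /andP[].
Qed.

HB.instance Definition _ :=
  @Order.POrder_MeetJoin_isLattice.Build _ T Tam_meet Tam_join Tam_meetP Tam_joinP.

End TamLattice.

Section Doubling.
Context {d : Order.disp_t} {L : finLatticeType d}.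
Implicit Types (C : {set L}) (x y z : L).

Definition convex C := forall x y z, x \in C -> z \in C -> x <= y <= z -> y \in C.

Definition ideal_of C : {set L} := [set y | [exists x in C, y <= x]].

Definition in_doubling C : pred (L *p bool) := fun u =>
  if u.2 then u.1 \in ~: ideal_of C :|: C else u.1 \in ideal_of C.

(* Convexity of C is what makes this subposet of L x bool a lattice. *)
Record doubling C (cvxC : convex C) := MkDoubling {
  doubling_val : L *p bool;
  _ : in_doubling C doubling_val
}.

Definition interval x y : {set L} := [set z | x <= z <= y].

Definition lower_pseudo_interval C := exists (a : L) (B : {set L}),
  [/\ B != set0, forall b, b \in B -> a <= b &
      C = \bigcup_(b in B) interval a b].

Lemma ideal_ofP C y : reflect (exists2 x, x \in C & y <= x) (y \in ideal_of C).
Proof. by rewrite inE; apply: exists_inP. Qed.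

Lemma ideal_of_le C x y : x <= y -> y \in ideal_of C -> x \in ideal_of C.
Proof.
by move=> le_xy /ideal_ofP[c Cc /(le_trans le_xy) le_xc]; apply/ideal_ofP; exists c.
Qed.

Lemma in_doubling0 C x : in_doubling C (x, false) = (x \in ideal_of C).
Proof. by []. Qed.

Lemma in_doubling1 C x :
  in_doubling C (x, true) = (x \notin ideal_of C) || (x \in C).
Proof. by rewrite /in_doubling /= in_setU in_setC. Qed.

End Doubling.

Section DoublingLattice.
Context {d : Order.disp_t} {L : finLatticeType d} {C : {set L}}.
Variable cvxC : convex C.
Local Notation D := (doubling cvxC).
Local Notation I := (ideal_of C).
Implicit Types u v w : D.

HB.instance Definition _ := [isSub for @doubling_val _ _ _ cvxC].
HB.instance Definition _ := [Finite of D by <:].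
HB.instance Definition _ := [SubChoice_isSubPOrder of D by <: with d].

Lemma doubling_leE u v :
  (u <= v) = ((val u).1 <= (val v).1) && ((val u).2 ==> (val v).2).
Proof.
rewrite -[u <= v]/(val u <= val v :> (L *p bool)) Order.ProdOrder.leEprod.
by congr (_ && _); case: (val u).2; case: (val v).2.
Qed.

Let meet_val u v : L *p bool :=
  let m := (val u).1 `&` (val v).1 in
  (m, [&& (val u).2, (val v).2 & (m \notin I) || (m \in C)]).

Let join_val u v : L *p bool :=
  let j := (val u).1 `|` (val v).1 in
  (j, [|| (val u).2, (val v).2 | j \notin I]).

Lemma meet_valP u v : in_doubling C (meet_val u v).
Proof.
case: u v => [[x e] /= xP] [[y f] /= yP]; rewrite /meet_val /=.
case: e xP => [xP|xI]; last first.
  by apply: ideal_of_le xI; apply: leIl.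
case: f yP => [yP|yI]; last first.
  by apply: ideal_of_le yI; apply: leIr.
rewrite andTb andTb; case: (boolP (_ || _)) => [mP|]; first by rewrite in_doubling1.
by rewrite negb_or negbK => /andP[].
Qed.

Lemma join_valP u v : in_doubling C (join_val u v).
Proof.
case: u v => [[x e] /= xP] [[y f] /= yP]; rewrite /join_val /=.
have key z j : z <= j -> in_doubling C (z, true) -> in_doubling C (j, true).
  move=> le_zj; rewrite !in_doubling1; case: (boolP (j \in I)) => //= jI.
  rewrite (ideal_of_le le_zj jI) /= => zC; have /ideal_ofP[c cC le_jc] := jI.
  by apply: cvxC zC cC _; rewrite le_zj.
case: e xP => [xP|xI]; first by apply: key xP; apply: leUl.
case: f yP => [yP|yI]; first by apply: key yP; apply: leUr.
by rewrite !orFb; case: (boolP (_ \in I)) => [//|jI]; rewrite in_doubling1 jI.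
Qed.

Definition doubling_meet u v : D := Sub _ (meet_valP u v).
Definition doubling_join u v : D := Sub _ (join_valP u v).

Lemma doubling_meetP w u v : (w <= doubling_meet u v) = (w <= u) && (w <= v).
Proof.
rewrite !doubling_leE /= lexI.
case: w u v => [[z g] /= zP] [[x e] /= xP] [[y f] /= yP].
case: g zP => [zP|_] /=; last by rewrite !andbT.
case: (boolP (z <= x)) => //= le_zx; case: (boolP (z <= y)) => //= le_zy;
  last by rewrite andbF.
case: e xP => //= xP; case: f yP => //= yP.
case: (boolP (x `&` y \in I)) => //= mI.
have le_zm : z <= x `&` y by rewrite lexI le_zx.
move: zP; rewrite in_doubling1 (ideal_of_le le_zm mI) /= => zC.
have /ideal_ofP[c cC le_mc] := mI.
by apply: cvxC zC cC _; rewrite le_zm.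
Qed.

Lemma doubling_joinP u v w : (doubling_join u v <= w) = (u <= w) && (v <= w).
Proof.
rewrite !doubling_leE /= leUx.
case: w u v => [[z g] /= zP] [[x e] /= xP] [[y f] /= yP].
case: g zP => [_|zI] /=; first by rewrite !implybT !andbT.
case: (boolP (x <= z)) => //= le_xz; case: (boolP (y <= z)) => //= le_yz;
  last by rewrite andbF.
have -> : (x `|` y \in I) by apply: ideal_of_le zI; rewrite leUx le_xz.
by case: e xP; case: f yP.
Qed.

HB.instance Definition _ := @Order.POrder_MeetJoin_isLattice.Build _ D
  doubling_meet doubling_join doubling_meetP doubling_joinP.

End DoublingLattice.

Definition order_isomorphic d (T : porderType d) d' (T' : porderType d') :=
  exists2 f : T -> T', bijective f & {mono f : x y / x <= y}.

Inductive iterated_lower_doubling : forall d, finLatticeType d -> Prop :=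
| iterated_lower_doubling_one :
    @iterated_lower_doubling _ 'I_1
| iterated_lower_doubling_step d (L : finLatticeType d) (C : {set L})
    (cvxC : convex C) :
    lower_pseudo_interval C -> iterated_lower_doubling L ->
    iterated_lower_doubling (doubling cvxC : finLatticeType d).

Definition join_congruence_uniform d (L : finLatticeType d) :=
  exists d' (L' : finLatticeType d'),
    iterated_lower_doubling L' /\ order_isomorphic L L'.

(* Main.v *)
Require Import Defs.
From mathcomp Require Import all_boot all_order.

(** Order the elements [(x, j)] of the disjoint union by [j] increasing, then
    by the number of [phi k] below [x] decreasing, then by [x] decreasing. For
    an initial segment [S] of this order, the traces on [S] of torclosed sets
    are the subsets of [S] closed under [(x, j) -> (y, j)] and
    [(x, i), (phi (i + 1), j) -> (y, j)], for [x <= y] and [i < j]. In a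
    nontrivial instance of the second rule both premises come before the
    conclusion, while in the first rule the conclusion comes before the premise.
    Hence a new element [e] can be added to a closed [X] exactly when [X]
    contains the filter [A] strictly above [e], and it can be left out exactly
    when the second rule does not force it, a condition inherited by subsets.
    Adding [e] to [S] thus doubles the convex set of the [X] above [A] that do
    not force [e], whose minimum is [A]. *)

Set Implicit Arguments.
Unset Strict Implicit.
Unset Printing Implicit Defensive.

Import Order.TTheory.
Local Open Scope order_scope.

Lemma exists_maximal_in (T : finType) (r : rel T) (S : {set T}) :
  irreflexive r -> transitive r -> S != set0 ->
  exists2 e, e \in S & forall u, u \in S -> ~~ r e u.
Proof.
move=> r_irr r_trans /set0Pn[v0 Sv0].
case: (arg_maxnP (fun v => #|[set u | r u v]|) Sv0) => e Se e_max.
exists e => // u Su; apply/negP => r_eu.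
have := e_max u Su; rewrite /= leqNgt => /negP; apply.
apply/proper_card/properP; split.
  by apply/subsetP => w; rewrite !inE => /r_trans; apply.
by exists e; rewrite !inE ?r_irr.
Qed.

(** * Set families represented by iterated doublings *)

Definition represents d (L : finLatticeType d) (E : finType)
    (fam : {set E} -> Prop) :=
  exists2 f : L -> {set E}, (forall x y, (f x \subset f y) = (x <= y)) &
    forall X, fam X <-> exists x, f x = X.

Definition doubling_representable (E : finType) (fam : {set E} -> Prop) :=
  exists d (L : finLatticeType d),
    iterated_lower_doubling L /\ represents L fam.

Lemma doubling_representable0 (E : finType) (fam : {set E} -> Prop) :
  (forall X, fam X <-> X = set0) -> doubling_representable fam.
Proof.
move=> famE; exists _, 'I_1; split; first exact: iterated_lower_doubling_one.
exists (fun=> set0) => [x y|X]; first by rewrite subxx !ord1 lexx.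
by split=> [/famE->|[_ <-]]; [exists ord0 | apply/famE].
Qed.

(** A forced [X] survives only as [e |: X], an [X] not containing [A] only as [X], and no [X] is of
    both kinds. Every other [X] yields two sets; these form the set [C] to be doubled. *)
Lemma doubling_representable_setU1 (E : finType) (fam fam' : {set E} -> Prop)
    (e : E) (A : {set E}) (forced : pred {set E}) :
    (forall X, fam X -> e \notin X) ->
    (forall X Y : {set E}, X \subset Y -> forced X -> forced Y) ->
    fam A -> ~~ forced A ->
    (forall X, fam X -> forced X -> A \subset X) ->
    (forall X, fam' X <->
       (fam X /\ ~~ forced X) \/
       (exists Y, [/\ fam Y, A \subset Y & X = e |: Y])) ->
  doubling_representable fam -> doubling_representable fam'.
Proof.
move=> notin_e forcedS famA nfA forcedA fam'E [d [L [L_iter [f f_mono famE]]]].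
have f_fam x : fam (f x) by apply/famE; exists x.
have f_e x : e \notin f x by apply: notin_e.
pose C : {set L} := [set x | (A \subset f x) && ~~ forced (f x)].
have nforced_le x y : x <= y -> ~~ forced (f y) -> ~~ forced (f x).
  by move=> le_xy; apply/contra/forcedS; rewrite f_mono.
have cvxC : convex C.
  move=> x y z; rewrite !inE => /andP[Ax _] /andP[_ nfz] /andP[le_xy le_yz].
  by rewrite (nforced_le _ _ le_yz nfz) (subset_trans Ax) // f_mono.
have [a fa] : exists a, f a = A by apply/famE.
have lowerC : lower_pseudo_interval C.
  have aC : a \in C by rewrite inE fa subxx.
  (* [C] itself provides the upper ends; convexity keeps each interval starting at [a] inside
     [C]. *)
  exists a, C; split; first by apply/set0Pn; exists a.
    by move=> b; rewrite inE => /andP[+ _]; rewrite -fa f_mono.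
  apply/setP => x; apply/idP/bigcupP => [xC|[b bC]].
    exists x => //; rewrite inE lexx andbT -f_mono fa.
    by move: xC; rewrite inE => /andP[].
  by rewrite inE; apply: cvxC.
exists _, (doubling cvxC : finLatticeType _); split.
  exact: iterated_lower_doubling_step.
have nforcedI x : x \in ideal_of C -> ~~ forced (f x).
  by case/ideal_ofP => c; rewrite inE => /andP[_ nfc] /nforced_le; apply.
have sub_ideal x : x \in C -> x \in ideal_of C.
  by move=> xC; apply/ideal_ofP; exists x.
(* Outside the ideal of [C] the second component is [true] even when [e] cannot
   be added, hence the condition on [A]. *)
pose adds (u : doubling cvxC) := (val u).2 && (A \subset f (val u).1).
pose g u := if adds u then e |: f (val u).1 else f (val u).1.
have ge u : (e \in g u) = adds u.
  by rewrite /g; case: ifP; rewrite ?setU11 ?(negPf (f_e _)).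
have gD u : g u :\ e = f (val u).1.
  rewrite /g; case: ifP => _; first by rewrite setU1K.
  by apply/setDidPl; rewrite disjoint_sym disjoints1.
have gS u v : (g u \subset g v)
    = (f (val u).1 \subset f (val v).1) && (adds u ==> adds v).
  apply/idP/andP => [sub_uv|[sub_uv add_uv]].
    split; first by rewrite -!gD setSD.
    by rewrite -!ge; apply/implyP/subsetP.
  rewrite {1}/g; case: ifP add_uv => /= [_ av|_ _].
    by rewrite subUset sub1set ge av /g av subsetU // sub_uv orbT.
  by rewrite (subset_trans sub_uv) // -gD subD1set.
exists g => [u v|X].
  rewrite gS f_mono doubling_leE; case: (boolP (_ <= _)) => //= le_uv.
  have le_f : f (val u).1 \subset f (val v).1 by rewrite f_mono.
  rewrite /adds; apply/implyP/implyP => [add_uv bu|bu_bv /andP[/bu_bv-> Au]];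
    last exact: subset_trans le_f.
  (* If [v] is on level [false], then [u] lies over the ideal of [C]. Being on level [true], it lies
     over [C], so it adds [e] while [v] does not. *)
  case: (boolP (val v).2) add_uv => //= bv; rewrite bu /=.
  have := valP v; rewrite /= /in_doubling (negPf bv) => /(ideal_of_le le_uv) uI.
  have := valP u; rewrite /= /in_doubling bu in_setU in_setC uI /= inE.
  by case/andP=> -> _ /(_ isT).
split=> [/fam'E|].
  case=> [[/famE[x <-] nf]|[Y [/famE[x <-] Ax ->]]].
    case: (boolP (x \in ideal_of C)) => xI.
      have xP : in_doubling C (x, false) by rewrite in_doubling0.
      by exists (MkDoubling cvxC xP).
    have xP : in_doubling C (x, true) by rewrite in_doubling1 xI.
    exists (MkDoubling cvxC xP); rewrite /g /adds /=; case: ifP => // Ax.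
    by case/negP: xI; apply: sub_ideal; rewrite inE Ax.
  have xP : in_doubling C (x, true).
    rewrite in_doubling1; case: (boolP (x \in ideal_of C)) => //= xI.
    by rewrite inE Ax nforcedI.
  by exists (MkDoubling cvxC xP); rewrite /g /adds /= Ax.
case=> u <-; apply/fam'E; rewrite /g; case: ifP => [/andP[_ Au]|/negP nadd].
  by right; exists (f (val u).1).
left; split=> //; apply/negP => fu; apply: nadd.
rewrite /adds (forcedA _ _ fu) // andbT.
have := valP u; rewrite /= /in_doubling; case: ifP => // _ /nforcedI.
by rewrite fu.
Qed.

(** * Traces of torclosed sets on initial segments *)

Section TamariTraces.
Context {d : Order.disp_t} {P : finPOrderType d} {n : nat} (phi : 'I_n -> P).
Hypothesis phi_lt : is_chain phi.
Local Notation E := (P * 'I_n)%type.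
Implicit Types (S X Y : {set E}) (u v w : E).

Definition chain_rank (x : P) := #|[set i | phi i <= x]|.

Lemma chain_rank_le x y : x <= y -> (chain_rank x <= chain_rank y)%N.
Proof.
move=> le_xy; apply/subset_leq_card/subsetP => i.
by rewrite !inE => /le_trans; apply.
Qed.

(** The indices [i] with [phi i <= y] form an initial segment of ['I_n], so their number decides
    whether [k] is among them. *)
Lemma phi_le_chain_rank k y :
  (chain_rank (phi k) <= chain_rank y)%N -> phi k <= y.
Proof.
apply: contraLR => nle; rewrite -ltnNge; apply/proper_card/properP; split.
  apply/subsetP => i; rewrite !inE => le_iy.
  case: (ltngtP i k) => [/phi_lt/ltW//|lt_ki|/val_inj->//].
  by case/negP: nle; apply: le_trans le_iy; apply/ltW/phi_lt.
by exists k; rewrite !inE.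
Qed.

(** Since [chain_rank] is monotone, the plain disjunction agrees with the lexicographic comparison
    of rank, then element. *)
Definition before : rel E := fun u v =>
  (u.2 < v.2)%N ||
  (u.2 == v.2) && ((chain_rank v.1 < chain_rank u.1)%N || (v.1 < u.1)).

Lemma before_irr : irreflexive before.
Proof. by move=> u; rewrite /before !ltnn eqxx ltxx. Qed.

Lemma before_trans : transitive before.
Proof.
move=> [y j] [x i] [z k]; rewrite /before /=.
case/orP=> [lt_ij|/andP[/eqP-> xy]].
  case/orP=> [/(ltn_trans lt_ij)->//|/andP[/eqP<- _]].
  by rewrite lt_ij.
case/orP=> [->//|/andP[/eqP-> yz]].
rewrite eqxx ltnn /=.
case/orP: xy => [lt_yx|lt_yx]; case/orP: yz => [lt_zy|lt_zy].
- by rewrite (ltn_trans lt_zy).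
- by rewrite (leq_ltn_trans (chain_rank_le (ltW lt_zy))).
- by rewrite (leq_trans lt_zy) // chain_rank_le // ltW.
- by rewrite (lt_trans lt_zy) ?orbT.
Qed.

Definition initial S :=
  S \subset C_P phi /\
  forall u v, u \in C_P phi -> v \in S -> before u v -> u \in S.

(** The torclosed rule is composed with upward closure because the intermediate [(x, u.2)] comes
    after [u] when [x < u.1], hence may be missing from an initial segment. *)
Definition tor_forced X u :=
  [exists x, exists i : 'I_n, exists i' : 'I_n,
    [&& i' == i.+1 :> nat, (i < u.2)%N, (x, i) \in X, (phi i', u.2) \in X
      & x <= u.1]].

Lemma tor_forcedP X (y : P) (j : 'I_n) :
  reflect (exists x (i i' : 'I_n),
            [/\ i' = i.+1 :> nat, (i < j)%N, (x, i) \in X, (phi i', j) \in X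
              & x <= y])
          (tor_forced X (y, j)).
Proof.
apply: (iffP existsP) => [[x /existsP[i /existsP[i' /and5P[/eqP]]]]|].
  by exists x, i, i'.
case=> x [i [i' [i'E ltij Xx Xi' le_xy]]]; exists x.
apply/existsP; exists i; apply/existsP; exists i'.
by rewrite i'E eqxx ltij Xx Xi'.
Qed.

Lemma tor_forcedS X Y u : X \subset Y -> tor_forced X u -> tor_forced Y u.
Proof.
case: u => y j /subsetP sXY /tor_forcedP[x [i [i' [i'E ltij Xx Xi' le_xy]]]].
by apply/tor_forcedP; exists x, i, i'; split=> //; apply: sXY.
Qed.

Lemma tor_forced_le X (y z : P) (j : 'I_n) :
  z <= y -> tor_forced X (z, j) -> tor_forced X (y, j).
Proof.
move=> le_zy /tor_forcedP[x [i [i' [i'E ltij Xx Xi' le_xz]]]].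
by apply/tor_forcedP; exists x, i, i'; split=> //; apply: le_trans le_zy.
Qed.

Definition tor_trace S X :=
  [/\ X \subset S,
      forall x y j, (x, j) \in X -> (y, j) \in S -> x <= y -> (y, j) \in X
    & forall u, u \in S -> tor_forced X u -> u \in X].

Lemma tor_trace_torclosed X : tor_trace (C_P phi) X <-> torclosed phi X.
Proof.
split=> [[sX upX clX]|/torclosedP[/order_filterP[sX upX] clX]].
  have sX' x i : (x, i) \in X -> x <= phi i.
    by move=> /(subsetP sX); rewrite in_C_P.
  apply/torclosedP; split.
    apply/order_filterP; split=> // x y i Xx le_xy le_y.
    by apply: upX Xx _ le_xy; rewrite in_C_P.
  move=> i i' j x i'E ltij Xx Xi'; apply: clX.
    by rewrite in_C_P (le_trans (sX' _ _ Xx)) // ltW // phi_lt.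
  by apply/tor_forcedP; exists x, i, i'.
split.
- by apply/subsetP => -[x i] /sX; rewrite in_C_P.
- by move=> x y j Xx; rewrite in_C_P => le_y le_xy; apply: upX Xx _ _.
case=> y j; rewrite in_C_P => le_y.
case/tor_forcedP => x [i [i' [i'E ltij Xx Xi' le_xy]]].
exact: (upX x _ _ (clX _ _ _ _ i'E ltij Xx Xi')).
Qed.

(** * Adding one maximal element to an initial segment *)

Section AddElement.
Variables (S : {set E}) (z : P) (j : 'I_n).
Let e : E := (z, j).
Hypothesis (Se : e \in S) (S_initial : initial S).
Hypothesis e_max : forall u, u \in S -> ~~ before e u.

Let A : {set E} := [set u in C_P phi | (u.2 == j) && (z < u.1)].

Lemma initial_setD1 : initial (S :\ e).
Proof.
case: S_initial => sS S_before; split.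
  exact: subset_trans (subD1set _ _) sS.
move=> u v Cu; rewrite !inE => /andP[_ Sv] uv.
rewrite (S_before u v) // andbT; apply/eqP => ue.
by have := e_max Sv; rewrite -ue uv.
Qed.

(** Elements strictly above [e] come before it, so initiality places all of [A] in [S]. *)
Lemma mem_above y k : ((y, k) \in A) = [&& k == j, (y, k) \in S & z < y].
Proof.
case: S_initial => /subsetP sS S_before; rewrite inE /=.
case: eqVneq => [->|_]; last by rewrite andbF.
case: (boolP (z < y)) => lt_zy; rewrite ?andbF // !andbT.
apply/idP/idP => [Cy|/sS//].
by apply: S_before Cy Se _; rewrite /before /= eqxx lt_zy !orbT.
Qed.

(** The two premises of the rule lie in different components, whereas [A] lies in one. *)
Lemma above_tor_forced u : ~~ tor_forced A u.
Proof.
case: u => y k; apply/negP => /tor_forcedP[x [i [i' [_ ltik]]]].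
rewrite !mem_above => /and3P[/eqP ij _ _] /and3P[/eqP kj _ _].
by rewrite ij kj ltnn in ltik.
Qed.

Lemma tor_trace_above : tor_trace (S :\ e) A.
Proof.
split=> [|x y k|u _ /(negP (above_tor_forced u))//].
  apply/subsetP => -[y k]; rewrite mem_above => /and3P[_ Sy lt_zy].
  by rewrite in_setD1 Sy xpair_eqE gt_eqF.
rewrite !mem_above in_setD1 => /and3P[-> _ lt_zx] /andP[_ ->] le_xy.
exact: lt_le_trans le_xy.
Qed.

(** Premises that force [e] also force everything above it. *)
Lemma tor_forced_above X :
  tor_trace (S :\ e) X -> tor_forced X e -> A \subset X.
Proof.
move=> [_ _ clX] Xe; apply/subsetP => u Au; apply: clX.
  by case: tor_trace_above => /subsetP sA _ _; apply: sA.
case: u Au => y k; rewrite mem_above => /and3P[/eqP-> _ /ltW le_zy].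
exact: tor_forced_le Xe.
Qed.

Lemma tor_trace_setD1 X : tor_trace S X -> tor_trace (S :\ e) (X :\ e).
Proof.
move=> [sX upX clX]; split; first exact: setSD.
  move=> x y k; rewrite !in_setD1 => /andP[_ Xx] /andP[-> Sy] le_xy.
  exact: upX Xx Sy le_xy.
move=> u; rewrite !in_setD1 => /andP[-> Su] fu.
by apply: clX => //; apply: tor_forcedS fu; apply: subD1set.
Qed.

Lemma tor_trace_skip X :
  tor_trace (S :\ e) X -> ~~ tor_forced X e -> tor_trace S X.
Proof.
move=> [sX upX clX] nf; split; first exact: subset_trans sX (subD1set _ _).
  move=> x y k Xx Sy le_xy; have /setD1P[xe Sx] := subsetP sX _ Xx.
  case: (eqVneq (y, k) e) => [[yz kj]|ye]; last first.
    by apply: upX Xx _ le_xy; rewrite in_setD1 ye.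
  (* When the conclusion is [e], the premise has [x < z] and so comes after [e], against
     maximality. *)
  case/negP: (e_max Sx); rewrite /before /= kj eqxx lt_neqAle -yz le_xy.
  by move: xe; rewrite /e kj -yz xpair_eqE eqxx andbT => ->; rewrite !orbT.
move=> u Su fu; apply: clX => //; rewrite in_setD1 Su andbT.
by apply: contraNneq nf => <-.
Qed.

Lemma tor_trace_setU1 X :
  tor_trace (S :\ e) X -> A \subset X -> tor_trace S (e |: X).
Proof.
move=> [sX upX clX] /subsetP sAX; split.
- by rewrite subUset sub1set Se (subset_trans sX) // subD1set.
- move=> x y k; rewrite !in_setU1.
  case: (eqVneq (y, k) e) => //= ye; case/orP => [/eqP[-> kj]|Xx] Sy le_xy.
    move: ye Sy; rewrite kj => ye Sy; apply: sAX.
    rewrite mem_above eqxx Sy lt_neqAle le_xy andbT.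
    by apply: contraNneq ye => <-; exact: eqxx.
  by apply: upX Xx _ le_xy; rewrite in_setD1 ye.
case=> y k Sy; rewrite in_setU1; case: (eqVneq (y, k) e) => //= ye.
case/tor_forcedP => x [i [i' [i'E ltik Xx Xi' le_xy]]].
(* [e] cannot be the premise [(x, i)], as the conclusion is in a later component and would come
   after [e]. *)
have Xx' : (x, i) \in X.
  case/setU1P: Xx => // -[_ ij]; case/negP: (e_max Sy).
  by rewrite /before /= -ij ltik.
case/setU1P: Xi' => [[zE kj]|Xi'].
  move: ye Sy; rewrite kj => ye Sy; apply: sAX; rewrite mem_above eqxx Sy /=.
  rewrite lt_neqAle; apply/andP; split.
    by apply: contraNneq ye => <-; exact: eqxx.
  (* [z = phi i'], and by maximality of [e] the rank of [y] is at least that of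
     [z]. *)
  rewrite -zE; apply: phi_le_chain_rank; rewrite leqNgt zE.
  by have := e_max Sy; rewrite /before /= eqxx ltnn /= negb_or => /andP[].
apply: clX; first by rewrite in_setD1 ye.
by apply/tor_forcedP; exists x, i, i'.
Qed.

Lemma tor_trace_add :
  doubling_representable (tor_trace (S :\ e)) ->
  doubling_representable (tor_trace S).
Proof.
apply: (@doubling_representable_setU1 _ _ _ e A (fun X => tor_forced X e)).
- by move=> X [sX _ _]; apply/negP => /(subsetP sX); rewrite !inE eqxx.
- by move=> X Y; apply: tor_forcedS.
- exact: tor_trace_above.
- exact: above_tor_forced.
- exact: tor_forced_above.
move=> X; split=> [trX|[[]|[Y [trY AY ->]]]]; first last.
- exact: tor_trace_setU1.
- exact: tor_trace_skip.
have trXe := tor_trace_setD1 trX; case: trX => sX upX clX.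
case: (boolP (e \in X)) => Xe.
  right; exists (X :\ e); split=> //; last by rewrite setD1K.
  apply/subsetP => -[y k]; rewrite mem_above => /and3P[/eqP-> Sy lt_zy].
  by rewrite in_setD1 (upX _ _ _ Xe Sy (ltW lt_zy)) xpair_eqE gt_eqF.
left; split; last by apply: contra Xe => /clX; apply.
suff <- : X :\ e = X by [].
by apply/setDidPl; rewrite disjoint_sym disjoints1.
Qed.

End AddElement.

Lemma tor_trace_representable S :
  initial S -> doubling_representable (tor_trace S).
Proof.
elim: {S}#|S| {-2}S (erefl #|S|) => [|m IHm] S cardS S_initial.
  move/cards0_eq: cardS => ->; apply: doubling_representable0 => X.
  split=> [[]|->]; first by rewrite subset0 => /eqP.
  by split=> [|x y j|u]; rewrite ?subxx ?inE.
have [|[z j] Se e_max] := exists_maximal_in before_irr before_trans (S := S).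
  by rewrite -card_gt0 cardS.
apply: (tor_trace_add Se) => //; apply: IHm; last exact: initial_setD1.
by move: cardS; rewrite (cardsD1 (z, j)) Se => -[].
Qed.

End TamariTraces.

Theorem theorem4p17 (d : Order.disp_t) (P : finBPOrderType d) (n : nat)
    (n_gt0 : (0 < n)%N) (phi : 'I_n -> P) (phi_lt : is_chain phi)
    (phi0 : phi (Ordinal n_gt0) = (\bot : P)%O) :
  join_congruence_uniform (Tam phi_lt : finLatticeType _).
Proof.
have C_initial : initial phi (C_P phi) by split.
have [d' [L [L_iter [f f_mono famE]]]] :=
  tor_trace_representable phi_lt C_initial.
exists d', L; split=> //.
have f_torclosed x : torclosed phi (f x).
  by apply/(tor_trace_torclosed phi_lt)/famE; exists x.
(* The boolean [==] lets [xchoose] extract a preimage, which defines the inverse of [f]. *)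
have f_onto (F : Tam phi_lt) : exists x, f x == val F.
  have /(tor_trace_torclosed phi_lt)/famE[x <-] := valP F.
  by exists x.
pose h F := xchoose (f_onto F).
have fh F : f (h F) = val F by apply/eqP/(xchooseP (f_onto F)).
exists h => [|F G]; last by rewrite -f_mono !fh Tam_leE.
exists (fun x => MkTam phi_lt (f_torclosed x)) => [F|x].
  by apply: val_inj; rewrite /= fh.
by apply/le_anti; rewrite -!f_mono !fh subxx.
Qed.
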